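(* Let $\lambda,\mu$ be two partitions of length $l$ such that $l\ge|\mu|\ge|\lambda|$. Set $m=\max(\lambda_1,\mu_1)$ and regard the conjugate partitions $\lambda'$ and $\mu'$ as partitions of length $m$ (by adding zero parts). Set $n=\max(\lambda'_1,\mu'_1)$, $\widetilde{\lambda}=(n-\lambda'_m,\dots,n-\lambda'_1)$, $\widetilde{\mu}=(n-\mu'_m,\dots,n-\mu'_1)$ and $\kappa_m=(1,\dots,1)\in\mathbb{Z}^m$. Then for any integer $k\ge\frac{|\mu|-|\lambda|}{2}$, $$\mathrm{(i)}\quad v_{\lambda,\mu}(q)=K^{D_m}_{\widetilde{\lambda}+k\kappa_m,\ \widetilde{\mu}+k\kappa_m}(q),\qquad \mathrm{(ii)}\quad V_{\lambda,\mu}(q)=K^{C_m}_{\widetilde{\lambda}+k\kappa_m,\ \widetilde{\mu}+k\kappa_m}(q).$$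
   Context: A partition of length $m$ is a sequence $\lambda_1\ge\dots\ge\lambda_m\ge 0$ of integers (zero parts allowed). $\varepsilon_1,\dots,\varepsilon_m$ is the standard basis of $\mathbb{Z}^m$, $|\alpha|=\alpha_1+\dots+\alpha_m$, and $\rho_m=(m,m-1,\dots,1)$. The symmetric group $\mathcal{S}_m$ acts on $\mathbb{Z}^m$ by permuting coordinates; $l(\cdot)$ applied to a group element denotes Coxeter length. Functions $f_q,F_q$ on $\mathbb{Z}^m$: they are defined by the expansions (each factor expanded as a geometric series in $q\,x_i/x_j$ or $q/(x_rx_s)$) $$\prod_{1\le i<j\le m}\frac{1}{1-q\frac{x_i}{x_j}}\prod_{1\le r<s\le m}\frac{1}{1-\frac{q}{x_rx_s}}=\sum_{\alpha\in\mathbb{Z}^m}f_q(\alpha)x^\alpha,\qquad \prod_{1\le i<j\le m}\frac{1}{1-q\frac{x_i}{x_j}}\prod_{1\le r\le s\le m}\frac{1}{1-\frac{q}{x_rx_s}}=\sum_{\alpha\in\mathbb{Z}^m}F_q(\alpha)x^\alpha .$$ For partitions $\nu,\eta$ of length $m$: $$u_{\nu,\eta}(q)=\sum_{\sigma\in\mathcal{S}_m}(-1)^{l(\sigma)}f_q(\sigma(\nu+\rho_m)-\eta-\rho_m),\qquad U_{\nu,\eta}(q)=\sum_{\sigma\in\mathcal{S}_m}(-1)^{l(\sigma)}F_q(\sigma(\nu+\rho_m)-\eta-\rho_m).$$ For $\lambda,\mu$ as in the claim, $v_{\lambda,\mu}(q)=u_{\lambda',\mu'}(q)$ and $V_{\lambda,\mu}(q)=U_{\lambda',\mu'}(q)$,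 where $\lambda',\mu'$ are regarded as partitions of length $m=\max(\lambda_1,\mu_1)$. Kostka-Foulkes polynomials: the positive roots are $R^+_{C_m}=\{\varepsilon_i\pm\varepsilon_j: 1\le i<j\le m\}\cup\{2\varepsilon_i:1\le i\le m\}$ and $R^+_{D_m}=\{\varepsilon_i\pm\varepsilon_j: 1\le i<j\le m\}$; $\rho_{C_m}=(m,m-1,\dots,1)$, $\rho_{D_m}=(m-1,m-2,\dots,0)$. $W_{C_m}$ is the group of all signed permutations of coordinates, $W_{D_m}$ its subgroup of elements changing an even number of signs, each with its Coxeter length. For $g=C_m$ or $D_m$, the $q$-Kostant partition function is defined by $\prod_{\alpha\in R_g^+}\frac{1}{1-qx^\alpha}=\sum_{\beta\in\mathbb{Z}^m}\mathcal{P}_q^{g}(\beta)x^\beta$, and for partitions $\nu,\eta$ of length $m$, $$K^{g}_{\nu,\eta}(q)=\sum_{w\in W_g}(-1)^{l(w)}\mathcal{P}^g_q(w(\nu+\rho_g)-(\eta+\rho_g)).$$ *)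

(* Defs.v *)
From mathcomp Require Import all_boot all_order all_fingroup all_algebra.
Set Implicit Arguments.
Unset Strict Implicit.
Unset Printing Implicit Defensive.
Import Order.TTheory GRing.Theory Num.Theory.
Local Open Scope ring_scope.

(* Coordinates are numbered from 0: the i-th coordinate of Z^m in the usual
   1-based numbering is coordinate i.-1 of 'rV[int]_m. *)

Definition eps (m : nat) (i : 'I_m) : 'rV[int]_m := delta_mx 0 i.

Definition kappa (m : nat) : 'rV[int]_m := const_mx 1.

(* Coefficient of q^d x^b in the product over r in R of the geometric series
   1 / (1 - q x^r) = \sum_k q^k x^(k r). *)
Fixpoint geom_coef (m : nat) (R : seq 'rV[int]_m) (d : nat) (b : 'rV[int]_m) :
    nat :=
  if R is r :: R' then (\sum_(k < d.+1) geom_coef R' (d - k) (b - r *+ k))%N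
  else (d == 0) && (b == 0).

(* Coefficient of x^b in the product over r in R of 1 / (1 - q x^r), as a
   polynomial in q.  The truncation degree is chosen so that nothing is lost
   for the families R used below: see coef_fq, coef_Fq, coef_KPC, coef_KPD. *)
Definition deg_bound (m : nat) (b : 'rV[int]_m) : nat :=
  (m * \sum_(j < m) `|b 0%R j|)%N.

Definition expansion (m : nat) (R : seq 'rV[int]_m) (b : 'rV[int]_m) :
    {poly int} :=
  \poly_(d < (deg_bound b).+1) (geom_coef R d b)%:R.

Definition diff_weights (m : nat) : seq 'rV[int]_m :=
  [seq eps i - eps j
  | i <- enum 'I_m, j <- [seq j : 'I_m <- enum 'I_m | (i < j)%N]].

Definition sum_weights_lt (m : nat) : seq 'rV[int]_m :=
  [seq eps i + eps j
  | i <- enum 'I_m, j <- [seq j : 'I_m <- enum 'I_m | (i < j)%N]].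

Definition sum_weights_le (m : nat) : seq 'rV[int]_m :=
  [seq eps i + eps j
  | i <- enum 'I_m, j <- [seq j : 'I_m <- enum 'I_m | (i <= j)%N]].

Definition double_weights (m : nat) : seq 'rV[int]_m :=
  [seq eps i *+ 2 | i <- enum 'I_m].

Definition fq_weights (m : nat) : seq 'rV[int]_m :=
  diff_weights m ++ [seq - r | r <- sum_weights_lt m].

Definition Fq_weights (m : nat) : seq 'rV[int]_m :=
  diff_weights m ++ [seq - r | r <- sum_weights_le m].

Definition fq (m : nat) (a : 'rV[int]_m) : {poly int} :=
  expansion (fq_weights m) a.

Definition Fq (m : nat) (a : 'rV[int]_m) : {poly int} :=
  expansion (Fq_weights m) a.

(* These lists have no repetitions, so they enumerate the sets of positive
   roots. *)
Definition posroots_C (m : nat) : seq 'rV[int]_m :=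
  diff_weights m ++ sum_weights_lt m ++ double_weights m.

Definition posroots_D (m : nat) : seq 'rV[int]_m :=
  diff_weights m ++ sum_weights_lt m.

Definition KPC (m : nat) (b : 'rV[int]_m) : {poly int} :=
  expansion (posroots_C m) b.

Definition KPD (m : nat) (b : 'rV[int]_m) : {poly int} :=
  expansion (posroots_D m) b.

Definition rho (m : nat) : 'rV[int]_m := \row_(i < m) (m%:Z - i%:Z).

Definition rho_C (m : nat) : 'rV[int]_m := rho m.

Definition rho_D (m : nat) : 'rV[int]_m := \row_(i < m) (m%:Z - i.+1%:Z).

(* Length of w with respect to the generating set S: the least n such that w
   is a product of n elements of S (a set power in group_scope).  Prefixes of
   a shortest word are distinct, so searching below #|gT| suffices when w is
   in <<S>>. *)
Definition cox_length (gT : finGroupType) (S : {set gT}) (w : gT) : nat :=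
  find (fun n => w \in (S ^+ n)%g) (iota 0 #|gT|).

Definition simple_A (m : nat) : {set 'S_m} :=
  [set s : 'S_m | [exists i : 'I_m, exists j : 'I_m,
     (j == i.+1 :> nat) && (s == tperm i j)]].

Definition perm_act (m : nat) (s : 'S_m) (a : 'rV[int]_m) : 'rV[int]_m :=
  col_perm s^-1%g a.

(* Signed permutations are the permutations of 'I_m * bool that commute with
   (i, b) |-> (i, ~~ b), where (i, b) stands for (-1)^b eps_i. *)
Definition W_C (m : nat) : {set {perm 'I_m * bool}} :=
  [set w : {perm 'I_m * bool} |
     [forall p : 'I_m * bool, w (p.1, ~~ p.2) == ((w p).1, ~~ (w p).2)]].

Definition W_D (m : nat) : {set {perm 'I_m * bool}} :=
  [set w in W_C m | ~~ odd #|[set i : 'I_m | (w (i, false)).2]|].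

(* If w sends (-1)^b eps_i to eps_j, then the j-th coordinate of w . a is
   (-1)^b a_i. *)
Definition signed_act (m : nat) (w : {perm 'I_m * bool}) (a : 'rV[int]_m) :
    'rV[int]_m :=
  \row_j (let p := (w^-1)%g (j, false) in (-1) ^+ p.2 * a 0 p.1).

(* Reflection in eps_i - eps_j (b = false) or in eps_i + eps_j (b = true). *)
Definition refl_pair (m : nat) (b : bool) (i j : 'I_m) : {perm 'I_m * bool} :=
  (tperm (i, false) (j, b) * tperm (i, true) (j, ~~ b))%g.

Definition refl_double (m : nat) (i : 'I_m) : {perm 'I_m * bool} :=
  tperm (i, false) (i, true).

Definition simple_C (m : nat) : {set {perm 'I_m * bool}} :=
  [set w : {perm 'I_m * bool} | [exists i : 'I_m, exists j : 'I_m,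
     (j == i.+1 :> nat) && (w == refl_pair false i j)]]
  :|: [set w : {perm 'I_m * bool} |
     [exists i : 'I_m, (i.+1 == m) && (w == refl_double i)]].

(* For m <= 1 this set is empty, in accordance with W_D being trivial. *)
Definition simple_D (m : nat) : {set {perm 'I_m * bool}} :=
  [set w : {perm 'I_m * bool} | [exists i : 'I_m, exists j : 'I_m,
     (j == i.+1 :> nat) && (w == refl_pair false i j)]]
  :|: [set w : {perm 'I_m * bool} | [exists i : 'I_m, exists j : 'I_m,
     [&& j == i.+1 :> nat, j.+1 == m & w == refl_pair true i j]]].

Definition u (m : nat) (nu eta : 'rV[int]_m) : {poly int} :=
  \sum_(s : 'S_m) (-1) ^+ cox_length (simple_A m) s *
    fq (perm_act s (nu + rho m) - eta - rho m).

Definition U (m : nat) (nu eta : 'rV[int]_m) : {poly int} :=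
  \sum_(s : 'S_m) (-1) ^+ cox_length (simple_A m) s *
    Fq (perm_act s (nu + rho m) - eta - rho m).

Definition KC (m : nat) (nu eta : 'rV[int]_m) : {poly int} :=
  \sum_(w in W_C m) (-1) ^+ cox_length (simple_C m) w *
    KPC (signed_act w (nu + rho_C m) - (eta + rho_C m)).

Definition KD (m : nat) (nu eta : 'rV[int]_m) : {poly int} :=
  \sum_(w in W_D m) (-1) ^+ cox_length (simple_D m) w *
    KPD (signed_act w (nu + rho_D m) - (eta + rho_D m)).

Definition is_partition (lam : seq nat) : Prop := sorted geq lam.

Definition first_part (lam : seq nat) : nat := head 0%N lam.

(* conj_part lam j is lambda'_(j+1). *)
Definition conj_part (lam : seq nat) (j : nat) : nat :=
  count (fun p => (j < p)%N) lam.

Definition conj_vec (m : nat) (lam : seq nat) : 'rV[int]_m :=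
  \row_(j < m) (conj_part lam j)%:Z.

Definition max_first (lam mu : seq nat) : nat :=
  maxn (first_part lam) (first_part mu).

Definition max_conj_first (lam mu : seq nat) : nat :=
  maxn (conj_part lam 0) (conj_part mu 0).

Definition v (lam mu : seq nat) : {poly int} :=
  let m := max_first lam mu in u (conj_vec m lam) (conj_vec m mu).

Definition V (lam mu : seq nat) : {poly int} :=
  let m := max_first lam mu in U (conj_vec m lam) (conj_vec m mu).

(* (n - lambda'_m, ..., n - lambda'_1) *)
Definition tilde (m n : nat) (lam : seq nat) : 'rV[int]_m :=
  \row_(i < m) (n%:Z - (conj_part lam (rev_ord i))%:Z).

Definition pairing (m : nat) (h : 'I_m -> int) (b : 'rV[int]_m) : int :=
  \sum_j h j * b 0 j.

Lemma pairingD m (h : 'I_m -> int) a b :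
  pairing h (a + b) = pairing h a + pairing h b.
Proof.
rewrite /pairing -big_split /=; apply: eq_bigr => j _.
by rewrite !mxE mulrDr.
Qed.

Lemma pairingN m (h : 'I_m -> int) a : pairing h (- a) = - pairing h a.
Proof.
rewrite /pairing -sumrN; apply: eq_bigr => j _.
by rewrite !mxE mulrN.
Qed.

Lemma pairingMn m (h : 'I_m -> int) a k : pairing h (a *+ k) = pairing h a *+ k.
Proof.
elim: k => [|k IH]; last by rewrite !mulrS pairingD IH.
by rewrite !mulr0n /pairing big1 // => j _; rewrite mxE mulr0.
Qed.

Lemma pairing_eps m (h : 'I_m -> int) i : pairing h (eps i) = h i.
Proof.
rewrite /pairing (bigD1 i) //= big1 => [|j jNi]; rewrite !mxE ?eqxx /=.
  by rewrite mulr1 addr0.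
by rewrite (negbTE jNi) mulr0.
Qed.

Lemma geom_coef_pairing m (h : 'I_m -> int) (R : seq 'rV[int]_m) d b :
  (forall r, r \in R -> 1 <= pairing h r) ->
  geom_coef R d b != 0%N -> d%:Z <= pairing h b.
Proof.
elim: R d b => [|r R IH] d b hR /=.
  rewrite eqb0 negbK => /andP[/eqP -> /eqP ->].
  by rewrite /pairing big1 // => j _; rewrite mxE mulr0.
rewrite sum_nat_eq0 negb_forall => /existsP[k /= Hk].
have := IH _ _ (fun r' Hr' => hR r' (mem_behead (s := r :: R) Hr')) Hk.
have h1 := hR r (mem_head _ _).
rewrite pairingD pairingN pairingMn -subzn ?leq_ord //.
rewrite lerBrDr => H; apply: le_trans H.
by rewrite -addrA lerDl addrC subr_ge0 -[X in X <= _]natz lerMn2r h1 orbT.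
Qed.

Lemma pairing_deg_bound m (h : 'I_m -> int) b :
  (forall j, `|h j| <= m%:Z) -> pairing h b <= (deg_bound b)%:Z.
Proof.
move=> hm; apply: le_trans (ler_norm _) _.
apply: le_trans (ler_norm_sum _ _ _) _.
rewrite /deg_bound PoszM -[X in _ <= _ * X]natz natr_sum mulr_sumr.
apply: ler_sum => j _; rewrite normrM natz abszE.
exact: ler_wpM2r.
Qed.

Lemma coef_expansion m (h : 'I_m -> int) (R : seq 'rV[int]_m) b d :
  (forall j, `|h j| <= m%:Z) -> (forall r, r \in R -> 1 <= pairing h r) ->
  (expansion R b)`_d = (geom_coef R d b)%:R.
Proof.
move=> hm hR; rewrite coef_poly ltnS; case: leqP => // Hd.
case: (geom_coef R d b =P 0%N) => [-> //|/eqP Hne].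
have := le_trans (geom_coef_pairing hR Hne) (pairing_deg_bound b hm).
by rewrite lez_nat leqNgt Hd.
Qed.

Definition height_f (m : nat) (j : 'I_m) : int := - j.+1%:Z.
Definition height_K (m : nat) (j : 'I_m) : int := m%:Z - j%:Z.

Lemma height_f_le m (j : 'I_m) : `|height_f j| <= m%:Z.
Proof. by rewrite normrN ger0_norm // lez_nat. Qed.

Lemma height_K_le m (j : 'I_m) : `|height_K j| <= m%:Z.
Proof. by rewrite /height_K subzn 1?ltnW // ger0_norm // lez_nat leq_subr. Qed.

Lemma height_f_diff m (r : 'rV[int]_m) :
  r \in diff_weights m -> 1 <= pairing (@height_f m) r.
Proof.
case/allpairsPdep => i [j [_]]; rewrite mem_filter => /andP[ij _ ->].
rewrite pairingD pairingN !pairing_eps /height_f opprK addrC subzn 1?ltnW //.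
by rewrite lez_nat subn_gt0.
Qed.

Lemma height_K_diff m (r : 'rV[int]_m) :
  r \in diff_weights m -> 1 <= pairing (@height_K m) r.
Proof.
case/allpairsPdep => i [j [_]]; rewrite mem_filter => /andP[ij _ ->].
rewrite pairingD pairingN !pairing_eps /height_K.
by rewrite opprB addrC addrA subrK subzn 1?ltnW // lez_nat subn_gt0.
Qed.

Lemma height_K_gt0 m (j : 'I_m) : 1 <= height_K j.
Proof. by rewrite /height_K subzn 1?ltnW // lez_nat subn_gt0. Qed.

Lemma coef_fq m (a : 'rV[int]_m) d :
  (fq a)`_d = (geom_coef (fq_weights m) d a)%:R.
Proof.
apply: (coef_expansion (h := @height_f m)); first exact: height_f_le.
move=> r; rewrite mem_cat => /orP[/height_f_diff //|].
case/mapP => _ /allpairsPdep[i [j [_ _ ->]]] ->.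
by rewrite pairingN pairingD !pairing_eps /height_f opprD !opprK -PoszD.
Qed.

Lemma coef_Fq m (a : 'rV[int]_m) d :
  (Fq a)`_d = (geom_coef (Fq_weights m) d a)%:R.
Proof.
apply: (coef_expansion (h := @height_f m)); first exact: height_f_le.
move=> r; rewrite mem_cat => /orP[/height_f_diff //|].
case/mapP => _ /allpairsPdep[i [j [_ _ ->]]] ->.
by rewrite pairingN pairingD !pairing_eps /height_f opprD !opprK -PoszD.
Qed.

Lemma height_K_sum m (r : 'rV[int]_m) :
  r \in sum_weights_lt m -> 1 <= pairing (@height_K m) r.
Proof.
case/allpairsPdep => i [j [_ _ ->]]; rewrite pairingD !pairing_eps.
apply: le_trans (height_K_gt0 i) _; rewrite lerDl.
exact: le_trans (height_K_gt0 j).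
Qed.

Lemma coef_KPC m (b : 'rV[int]_m) d :
  (KPC b)`_d = (geom_coef (posroots_C m) d b)%:R.
Proof.
apply: (coef_expansion (h := @height_K m)); first exact: height_K_le.
move=> r; rewrite !mem_cat => /or3P[/height_K_diff //|/height_K_sum //|].
case/mapP => i _ ->; rewrite pairingMn pairing_eps.
rewrite mulr2n; apply: le_trans (height_K_gt0 i) _; rewrite lerDl.
exact: le_trans (height_K_gt0 i).
Qed.

Lemma coef_KPD m (b : 'rV[int]_m) d :
  (KPD b)`_d = (geom_coef (posroots_D m) d b)%:R.
Proof.
apply: (coef_expansion (h := @height_K m)); first exact: height_K_le.
by move=> r; rewrite mem_cat => /orP[/height_K_diff //|/height_K_sum //].
Qed.

(* Main.v *)
(* The involution b |-> - w0 b of Z^m (negrev, with w0 the reversal of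
   coordinates) fixes the roots eps_i - eps_j as a set and turns - eps_r - eps_s
   into eps_r + eps_s, so it carries f_q and F_q to the partition functions of
   types D and C.  It commutes with S_m up to conjugation by w0 and sends
   lambda' + rho_m to lambda~ + k kappa + rho_g up to a multiple of kappa, which
   cancels in the differences: u and U are the parts of K^D and K^C indexed by
   S_m.  A Weyl group element with a nonempty set I of sign changes lowers the
   coordinate sum by 2 * \sum_(i in I) (lambda~ + k kappa + rho_g)_i, which for
   these k exceeds |mu| - |lambda|; its argument then has negative coordinate
   sum, hence is not a nonnegative combination of positive roots. *)

From HB Require Import structures.
Require Import Defs.
From mathcomp Require Import all_boot all_order all_fingroup all_algebra.
From mathcomp Require Import zify ring lra.
Set Implicit Arguments.
Unset Strict Implicit.
Unset Printing Implicit Defensive.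
Import Order.TTheory GRing.Theory Num.Theory.
Local Open Scope ring_scope.

(** * Partition functions *)

(** Both sides unfold to one double sum over exponents [i + j <= d], in which the two weights play
    symmetric roles. *)
Lemma geom_coef_swap m (r s : 'rV[int]_m) R d b :
  geom_coef [:: r, s & R] d b = geom_coef [:: s, r & R] d b.
Proof.
have expand x y : geom_coef [:: x, y & R] d b =
    (\sum_(i < d.+1) \sum_(j < d.+1 | i + j <= d)
        geom_coef R (d - (i + j)) (b - x *+ i - y *+ j))%N.
  rewrite /=; apply: eq_bigr => i _.
  rewrite (big_ord_widen _ (fun j => geom_coef R (d - i - j)
    (b - x *+ i - y *+ j)) (leq_subr i d : (d - i < d.+1)%N)).
  apply: eq_big => [j|j _]; last by rewrite subnDA.
  by rewrite ltnS leq_subRL // -ltnS.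
rewrite !expand (exchange_big_dep xpredT) //=.
by apply: eq_bigr => j _; apply: eq_big => [i|i _]; rewrite addnC // addrAC.
Qed.

Lemma geom_coef_cons m (r : 'rV[int]_m) R R' :
  geom_coef R =2 geom_coef R' -> geom_coef (r :: R) =2 geom_coef (r :: R').
Proof. by move=> e d b /=; apply: eq_bigr => k _; rewrite e. Qed.

Lemma geom_coef_perm m (R R' : seq 'rV[int]_m) d b :
  perm_eq R R' -> geom_coef R d b = geom_coef R' d b.
Proof.
have move_head (x : 'rV[int]_m) s t :
    geom_coef (s ++ x :: t) =2 geom_coef (x :: s ++ t).
  elim: s => [|y s IH] d' b' //=; rewrite -/(geom_coef (y :: s ++ x :: t) d' b').
  by rewrite (geom_coef_cons _ IH) geom_coef_swap.
(* Invariance under exchanging two adjacent blocks is enough; [s1] is moved past [s2] one weight at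
   a time. *)
apply: (catCA_perm_subst (F := fun R => geom_coef R d b)) => s1 s2 s3.
elim: s1 d b => [|x s1 IH] d' b' //.
by rewrite move_head !cat_cons (geom_coef_cons _ IH).
Qed.

Lemma geom_coef_map m (phi : {additive 'rV[int]_m -> 'rV[int]_m}) R d b :
  injective phi -> geom_coef [seq phi r | r <- R] d (phi b) = geom_coef R d b.
Proof.
move=> phi_inj; elim: R d b => [|r R IH] d b /=.
  by rewrite -{1}(raddf0 phi) (inj_eq phi_inj).
by apply: eq_bigr => k _; rewrite -raddfMn -raddfB IH.
Qed.

(** A weak form of [geom_coef_pairing] for functionals that may vanish on weights, as the coordinate
    sum does on [eps i - eps j]. It controls the support but not the degree. *)
Lemma geom_coef_pairing_ge0 m (h : 'I_m -> int) (R : seq 'rV[int]_m) d b :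
  (forall r, r \in R -> 0 <= pairing h r) ->
  geom_coef R d b != 0%N -> 0 <= pairing h b.
Proof.
elim: R d b => [|r R IH] d b hR /=.
  rewrite eqb0 negbK => /andP[_ /eqP ->].
  by rewrite /pairing big1 // => j _; rewrite mxE mulr0.
rewrite sum_nat_eq0 negb_forall => /existsP[k /= Hk].
have := IH _ _ (fun r' Hr' => hR r' (mem_behead (s := r :: R) Hr')) Hk.
rewrite pairingD pairingN pairingMn subr_ge0; apply: le_trans.
by rewrite mulrn_wge0 // hR ?mem_head.
Qed.

(** * Negation with reversal of coordinates, and its effect on the weights *)

Definition negrev m (a : 'rV[int]_m) : 'rV[int]_m := \row_i - a 0 (rev_ord i).

Lemma negrev_is_zmod_morphism m : zmod_morphism (@negrev m).
Proof. by move=> a b; apply/rowP => i; rewrite !mxE opprD. Qed.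

HB.instance Definition _ m :=
  GRing.isZmodMorphism.Build _ _ (@negrev m) (@negrev_is_zmod_morphism m).

Lemma negrevK m : involutive (@negrev m).
Proof. by move=> a; apply/rowP => i; rewrite !mxE rev_ordK opprK. Qed.

Lemma negrev_eps m (i : 'I_m) : negrev (eps i) = - eps (rev_ord i).
Proof. by apply/rowP => j; rewrite !mxE (can2_eq (@rev_ordK _) (@rev_ordK _)). Qed.

Lemma uniq_pairs m (e : rel 'I_m) :
  uniq [seq (i, j) | i <- enum 'I_m, j <- [seq j : 'I_m <- enum 'I_m | e i j]].
Proof.
apply: allpairs_uniq_dep => [|i _|]; first exact: enum_uniq.
  by rewrite filter_uniq // enum_uniq.
by move=> [i j] [i' j'] _ _ [-> ->].
Qed.

Lemma mem_pairs m (e : rel 'I_m) p :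
  (p \in [seq (i, j) | i <- enum 'I_m, j <- [seq j : 'I_m <- enum 'I_m | e i j]])
  = e p.1 p.2.
Proof.
case: p => i j; apply/allpairsPdep/idP => [[i' [j' [_]]]|eij].
  by rewrite mem_filter => /andP[eij _ [-> ->]].
by exists i, j; split; rewrite ?mem_enum // mem_filter mem_enum andbT.
Qed.

(** The action of [negrev] on index pairs: [eps i - eps j] goes to
    [eps (rev_ord j) - eps (rev_ord i)]. The order [i < j] is preserved because the pair is swapped
    as well. *)
Definition swap_rev m (p : 'I_m * 'I_m) := (rev_ord p.2, rev_ord p.1).

Lemma swap_revK m : involutive (@swap_rev m).
Proof. by case=> i j; rewrite /swap_rev /= !rev_ordK. Qed.

Lemma perm_swap_rev m (e : rel 'I_m) :
  (forall i j, e (rev_ord j) (rev_ord i) = e i j) ->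
  let s := [seq (i, j) | i <- enum 'I_m, j <- [seq j : 'I_m <- enum 'I_m | e i j]] in
  perm_eq [seq swap_rev p | p <- s] s.
Proof.
move=> e_rev /=; apply: uniq_perm; rewrite ?map_inj_uniq ?uniq_pairs //.
  exact: (can_inj (@swap_revK m)).
move=> p; rewrite mem_pairs -[p in LHS](@swap_revK m).
by rewrite mem_map ?mem_pairs ?e_rev //; apply: (can_inj (@swap_revK m)).
Qed.

Lemma map_pairs m (e : rel 'I_m) T (f : 'I_m -> 'I_m -> T) :
  [seq f i j | i <- enum 'I_m, j <- [seq j : 'I_m <- enum 'I_m | e i j]] =
  [seq f p.1 p.2
  | p <- [seq (i, j) | i <- enum 'I_m, j <- [seq j : 'I_m <- enum 'I_m | e i j]]].
Proof. by rewrite map_allpairs. Qed.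

Lemma perm_negrev_diff m :
  perm_eq [seq negrev r | r <- diff_weights m] (diff_weights m).
Proof.
rewrite /diff_weights map_pairs.
have /perm_swap_rev /= : forall i j : 'I_m, (rev_ord j < rev_ord i)%N = (i < j)%N.
  by move=> i j /=; have := ltn_ord i; have := ltn_ord j; lia.
(* The list of index pairs is abstracted: only its stability under [swap_rev] matters from here
   on. *)
move: (flatten _) => s s_perm.
rewrite -(permPr (perm_map (fun p => eps p.1 - eps p.2) s_perm)).
rewrite -!map_comp (eq_map (g := fun p => eps (swap_rev p).1 - eps (swap_rev p).2)) //.
by move=> p; rewrite /= raddfB /= !negrev_eps opprK addrC.
Qed.

Lemma perm_negrev_opp_sum m (e : rel 'I_m) :
  (forall i j, e (rev_ord j) (rev_ord i) = e i j) ->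
  let s := [seq eps i + eps j
           | i <- enum 'I_m, j <- [seq j : 'I_m <- enum 'I_m | e i j]] in
  perm_eq [seq negrev r | r <- [seq - r | r <- s]] s.
Proof.
rewrite /= map_pairs => /perm_swap_rev /=.
move: (flatten _) => s s_perm.
rewrite -(permPr (perm_map (fun p => eps p.1 + eps p.2) s_perm)).
rewrite -!map_comp (eq_map (g := fun p => eps (swap_rev p).1 + eps (swap_rev p).2)) //.
by move=> p; rewrite /= raddfN raddfD /= !negrev_eps opprD !opprK addrC.
Qed.

(** The diagonal pairs give the long roots, which is the difference between types D and C. *)
Lemma perm_sum_weights_le m :
  perm_eq (sum_weights_le m) (sum_weights_lt m ++ double_weights m).
Proof.
have -> : double_weights m =
    [seq eps p.1 + eps p.2 | p <- [seq (i, i) | i <- enum 'I_m]].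
  by rewrite -map_comp.
rewrite /sum_weights_le map_pairs.
rewrite /sum_weights_lt (map_pairs (fun i j => (i < j)%N)) -map_cat.
apply: perm_map; apply: uniq_perm.
- exact: uniq_pairs.
- rewrite cat_uniq uniq_pairs map_inj_uniq ?enum_uniq => [|i j [] //].
  rewrite andbT; apply/hasPn => _ /mapP[i _ ->].
  by rewrite mem_pairs ltnn.
move=> [i j]; rewrite mem_cat !mem_pairs /= leq_eqVlt orbC; congr (_ || _).
apply/eqP/mapP => [/val_inj ->|[k _ [-> ->]] //].
by exists j; rewrite ?mem_enum.
Qed.

Lemma fq_negrev m (a : 'rV[int]_m) : fq a = KPD (negrev a).
Proof.
apply/polyP => d; rewrite coef_fq coef_KPD; congr _%:R.
rewrite -(geom_coef_map _ _ _ (can_inj (@negrevK m))).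
apply: geom_coef_perm; rewrite map_cat perm_cat ?perm_negrev_diff //.
apply: perm_negrev_opp_sum => i j /=.
have := ltn_ord i; have := ltn_ord j; lia.
Qed.

Lemma Fq_negrev m (a : 'rV[int]_m) : Fq a = KPC (negrev a).
Proof.
apply/polyP => d; rewrite coef_Fq coef_KPC; congr _%:R.
rewrite -(geom_coef_map _ _ _ (can_inj (@negrevK m))).
apply: geom_coef_perm; rewrite map_cat perm_cat ?perm_negrev_diff //.
rewrite -(permPr (perm_sum_weights_le m)); apply: perm_negrev_opp_sum => i j /=.
have := ltn_ord i; have := ltn_ord j; lia.
Qed.

(** * Vanishing at weights of negative coordinate sum *)

Definition coord_sum m (b : 'rV[int]_m) : int := \sum_j b 0 j.

Lemma pairing1 m (b : 'rV[int]_m) : pairing (fun=> 1) b = coord_sum b.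
Proof. by apply: eq_bigr => j _; rewrite mul1r. Qed.

Lemma expansion_eq0 m (R : seq 'rV[int]_m) (b : 'rV[int]_m) :
  {in R, forall r, 0 <= coord_sum r} -> coord_sum b < 0 -> expansion R b = 0.
Proof.
rewrite -pairing1 => R_ge0 b_lt0; apply/polyP => d; rewrite coef0 coef_poly.
case: ifP => // _; case: (geom_coef R d b =P 0%N) => [-> //|/eqP b_n0].
move: b_lt0; rewrite ltNge (geom_coef_pairing_ge0 _ b_n0) // => r /R_ge0.
by rewrite pairing1.
Qed.

Lemma coord_sum_posroots_C m : {in posroots_C m, forall r, 0 <= coord_sum r}.
Proof.
move=> r; rewrite -pairing1 !mem_cat => /or3P[].
- by case/allpairsPdep=> i [j [_ _ ->]]; rewrite pairingD pairingN !pairing_eps.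
- by case/allpairsPdep=> i [j [_ _ ->]]; rewrite pairingD !pairing_eps.
- by case/mapP=> i _ ->; rewrite pairingMn pairing_eps.
Qed.

Lemma KPC_eq0 m (b : 'rV[int]_m) : coord_sum b < 0 -> KPC b = 0.
Proof. exact/expansion_eq0/coord_sum_posroots_C. Qed.

Lemma KPD_eq0 m (b : 'rV[int]_m) : coord_sum b < 0 -> KPD b = 0.
Proof.
apply: expansion_eq0 => r r_D; apply: coord_sum_posroots_C.
by rewrite /posroots_C catA mem_cat r_D.
Qed.

(** * Signed permutations *)

(* In a shortest word for w of length n, an n-fold product, the prefixes are
   pairwise distinct, whence n < #|gT|. *)
Lemma mem_expg_cox_length (gT : finGroupType) (S : {set gT}) w n :
  w \in (S ^+ n)%g -> w \in (S ^+ cox_length S w)%g.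
Proof.
move=> w_n; have ex_n : exists n, w \in (S ^+ n)%g by exists n.
have [k w_k k_min] := ex_minnP ex_n.
suff k_lt : (k < #|gT|)%N.
  have has_k : has (fun n => w \in (S ^+ n)%g) (iota 0 #|gT|).
    by apply/hasP; exists k; rewrite ?mem_iota.
  have := nth_find 0%N has_k; rewrite nth_iota ?add0n //.
  by rewrite -{2}(size_iota 0 #|gT|) -has_find.
have prefix (i : 'I_k.+1) :
    exists x, x \in (S ^+ i)%g /\ (x^-1 * w)%g \in (S ^+ (k - i))%g.
  have := w_k; rewrite -{1}(subnKC (leq_ord i)) expgD => /mulsgP[x y xS yS ->].
  by exists x; rewrite mulKg.
have [f fP] := fin_all_exists prefix.
rewrite -(card_ord k.+1); apply: (leq_card f).
(* If two prefixes agree, deleting the letters between them leaves a word for [w] of length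
   [i + (k - j) < k], against minimality. *)
have no_lt (i j : 'I_k.+1) : f i = f j -> ~ (i < j)%N.
  move=> f_ij lt_ij; have [fi _] := fP i; have [_ fj] := fP j.
  have := mem_mulg fi fj; rewrite -f_ij mulKVg -expgD => /k_min.
  have := leq_ord j; lia.
move=> i j f_ij; apply/val_inj => /=.
by case: (ltngtP i j) => // [/(no_lt _ _ f_ij)|/(no_lt _ _ (esym f_ij))].
Qed.

Lemma mem_expg_gen (gT : finGroupType) (S : {set gT}) w :
  w \in <<S>>%g -> exists n, w \in (S ^+ n)%g.
Proof.
case/gen_prodgP => n [c cS ->]; exists n.
elim: n c cS => [|n IH] c cS; first by rewrite big_ord0 expg0 inE.
by rewrite big_ord_recr expgSr mem_mulg // IH.
Qed.

Lemma gen_simple_A m : <<simple_A m>>%g = [set: 'S_m]%g.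
Proof.
have gen_lt d (i j : 'I_m) : (j = i + d.+1 :> nat)%N ->
    tperm i j \in <<simple_A m>>%g.
  elim: d j => [|d IH] j ij.
    apply: mem_gen; rewrite inE; apply/existsP; exists i; apply/existsP.
    by exists j; rewrite eqxx andbT ij addn1.
  have lt_j' : (j.-1 < m)%N by have := ltn_ord j; lia.
  pose j' := Ordinal lt_j'.
  have Nj'j : j' != j by rewrite -val_eqE /=; lia.
  have Nij : i != j by rewrite -val_eqE /=; lia.
  (* Induction on the distance: conjugating the adjacent transposition of [j - 1] and [j] by that of
     [i] and [j - 1] gives [tperm i j]. *)
  rewrite -(tpermJ_tperm Nj'j Nij) groupJ //.
    apply: mem_gen; rewrite inE; apply/existsP; exists j'; apply/existsP.
    by exists j; rewrite eqxx andbT /=; apply/eqP; lia.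
  by rewrite tpermC IH //=; lia.
apply/eqP; rewrite eqEsubset subsetT; apply/subsetP => s _.
have [ts -> _] := prod_tpermP s; rewrite group_prod // => -[i j] _ /=.
case: (ltngtP i j) => [ij|ij|/val_inj <-]; last by rewrite tperm1 group1.
  by apply: (gen_lt (j - i).-1); lia.
by rewrite tpermC; apply: (gen_lt (i - j).-1); lia.
Qed.

Lemma succ_ord_neq m (i j : 'I_m) : j = i.+1 :> nat -> i != j.
Proof. by move=> ij; rewrite -val_eqE /= ij neq_ltn ltnSn. Qed.

Lemma odd_word_A m n (s : 'S_m) : s \in (simple_A m ^+ n)%g -> odd n = odd_perm s.
Proof.
elim: n s => [|n IH] s; first by rewrite expg0 inE => /eqP ->; rewrite odd_perm1.
rewrite expgSr => /mulsgP[x y /IH x_odd]; rewrite inE.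
case/existsP=> i /existsP[j /andP[/eqP ij /eqP ->]] ->.
by rewrite odd_permM odd_tperm -x_odd succ_ord_neq // addbT.
Qed.

(** All words in adjacent transpositions for [s] have the parity of [s], in particular a shortest
    one. *)
Lemma sign_cox_length_A m (s : 'S_m) :
  (-1) ^+ cox_length (simple_A m) s = (-1) ^+ odd_perm s :> {poly int}.
Proof.
have : s \in <<simple_A m>>%g by rewrite gen_simple_A inE.
by case/mem_expg_gen => n /mem_expg_cox_length/odd_word_A <-; rewrite signr_odd.
Qed.

(** * The symmetric group inside the signed permutations *)

Section EmbedSym.

Variable m : nat.
Implicit Types (s : 'S_m) (w : {perm 'I_m * bool}) (p : 'I_m * bool).

Lemma embed_sym_inj s : injective (fun p => (s p.1, p.2)).
Proof. by move=> [i b] [j c] [/perm_inj -> ->]. Qed.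

Definition embed_sym s : {perm 'I_m * bool} := perm (@embed_sym_inj s).

Lemma embed_symE s p : embed_sym s p = (s p.1, p.2).
Proof. by rewrite permE. Qed.

Lemma embed_symM : {morph embed_sym : s t / (s * t)%g >-> (s * t)%g}.
Proof. by move=> s t; apply/permP => p; rewrite permM !embed_symE permM. Qed.

Lemma embed_sym1 : embed_sym 1%g = 1%g.
Proof. by apply/permP => -[i b]; rewrite embed_symE !perm1. Qed.

Lemma embed_symV s : embed_sym s^-1%g = (embed_sym s)^-1%g.
Proof. by apply: (mulgI (embed_sym s)); rewrite -embed_symM !mulgV embed_sym1. Qed.

Lemma embed_sym_injective : injective embed_sym.
Proof.
move=> s t st; apply/permP => i.
by have /permP/(_ (i, false)) := st; rewrite !embed_symE => -[].
Qed.

Lemma refl_pairE b (i j : 'I_m) p : i != j ->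
  refl_pair b i j p =
    if p.1 == i then (j, p.2 (+) b) else if p.1 == j then (i, p.2 (+) b) else p.
Proof.
case: p => k c Nij; rewrite /refl_pair permM !permE /= !xpair_eqE.
have Nji : j != i by rewrite eq_sym.
have [->|Nki] /= := eqVneq k i; last have [->|Nkj] /= := eqVneq k j.
- case: b c => [] []; rewrite ?(negbTE Nij) /= ?permE /= ?xpair_eqE ?eqxx;
    by rewrite ?(negbTE Nij) ?(negbTE Nji).
- case: b c => [] []; rewrite ?(negbTE Nji) /= ?permE /= ?xpair_eqE ?eqxx;
    by rewrite ?(negbTE Nij) ?(negbTE Nji).
by rewrite !xpair_eqE (negbTE Nki) (negbTE Nkj).
Qed.

Lemma embed_tperm (i j : 'I_m) : i != j -> embed_sym (tperm i j) = refl_pair false i j.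
Proof.
move=> Nij; apply/permP => -[k c]; rewrite embed_symE refl_pairE //= addbF.
case: tpermP => [->|->|/eqP/negbTE -> /eqP/negbTE ->] //; rewrite ?eqxx //.
by rewrite eq_sym (negbTE Nij).
Qed.

(** Supplies words for embedded permutations, without which [cox_length] would be only the default
    value of [find]. *)
Lemma mem_embed_expg (S : {set {perm 'I_m * bool}}) n s :
  (forall t, t \in simple_A m -> embed_sym t \in S) ->
  s \in (simple_A m ^+ n)%g -> embed_sym s \in (S ^+ n)%g.
Proof.
move=> embS; elim: n s => [|n IH] s.
  by rewrite !expg0 !inE => /eqP ->; rewrite embed_sym1.
rewrite !expgSr => /mulsgP[x y /IH xS /embS yS ->].
by rewrite embed_symM mem_mulg.
Qed.

Lemma embed_simple_C t : t \in simple_A m -> embed_sym t \in simple_C m.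
Proof.
rewrite inE => /existsP[i /existsP[j /andP[ij /eqP ->]]].
rewrite embed_tperm ?(succ_ord_neq (eqP ij)) //.
rewrite !inE; apply/orP; left; apply/existsP; exists i; apply/existsP.
by exists j; rewrite ij /=.
Qed.

Lemma embed_simple_D t : t \in simple_A m -> embed_sym t \in simple_D m.
Proof.
rewrite inE => /existsP[i /existsP[j /andP[ij /eqP ->]]].
rewrite embed_tperm ?(succ_ord_neq (eqP ij)) //.
rewrite !inE; apply/orP; left; apply/existsP; exists i; apply/existsP.
by exists j; rewrite ij /=.
Qed.

Lemma odd_refl_pair b (i j : 'I_m) : i != j -> odd_perm (refl_pair b i j) = false.
Proof.
by move=> Nij; rewrite /refl_pair odd_permM !odd_tperm !xpair_eqE !(negbTE Nij).
Qed.

(** A permutation acts in parallel on the two copies of ['I_m], so each transposition becomes a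
    product of two. *)
Lemma odd_embed_sym s : odd_perm (embed_sym s) = false.
Proof.
have [ts -> Dts] := prod_tpermP s; elim: ts Dts => [|[i j] ts IH] /=.
  by rewrite big_nil embed_sym1 odd_perm1.
case/andP=> Nij /IH ts_even; rewrite big_cons embed_symM odd_permM ts_even.
by rewrite embed_tperm // odd_refl_pair.
Qed.

Lemma refl_pair_fst b (i j : 'I_m) p : i != j ->
  (refl_pair b i j p).1 = tperm i j p.1.
Proof.
move=> Nij; rewrite refl_pairE // permE /=.
by case: ifP => // _; case: ifP.
Qed.

(* odd_perm w is the parity of the number of sign changes; together with the
   sign of the underlying permutation it makes up the sign character of W_C. *)
Lemma odd_word_C n w : w \in (simple_C m ^+ n)%g ->
  exists2 t : 'S_m, (forall p, (w p).1 = t p.1) & odd n = odd_perm t (+) odd_perm w.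
Proof.
elim: n w => [|n IH] w.
  rewrite expg0 inE => /eqP ->; exists 1%g; last by rewrite !odd_perm1.
  by move=> p; rewrite !perm1.
rewrite expgSr => /mulsgP[x y /IH[t xt n_odd]]; rewrite !inE => /orP[].
  case/existsP=> i /existsP[j /andP[/eqP ij /eqP ->]] ->.
  have Nij := succ_ord_neq ij.
  exists (t * tperm i j)%g => [p|]; first by rewrite permM (permM x) refl_pair_fst // xt.
  rewrite (odd_permM x) (odd_permM t) odd_refl_pair // odd_tperm Nij /= n_odd.
  by rewrite addbF addbT addNb.
case/existsP=> i /andP[_ /eqP ->] ->; exists t => [p|].
  rewrite permM -xt; move: (x p) => {}p; rewrite permE /=.
  by case: ifP => [/eqP -> //|_]; case: ifP => [/eqP ->|].
by rewrite odd_permM odd_tperm xpair_eqE andbF addbT /= n_odd addbN.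
Qed.

(** Every generator of type D lies over a transposition of ['I_m], so the sign is that of the
    underlying permutation [t]. *)
Lemma odd_word_D n w : w \in (simple_D m ^+ n)%g ->
  exists2 t : 'S_m, (forall p, (w p).1 = t p.1) & odd n = odd_perm t.
Proof.
elim: n w => [|n IH] w.
  rewrite expg0 inE => /eqP ->; exists 1%g; last by rewrite !odd_perm1.
  by move=> p; rewrite !perm1.
rewrite expgSr => /mulsgP[x y /IH[t xt n_odd]].
have step b (i j : 'I_m) : j = i.+1 :> nat -> w = (x * refl_pair b i j)%g ->
    exists2 t : 'S_m, (forall p, (w p).1 = t p.1) & odd n.+1 = odd_perm t.
  move=> ij ->; have Nij := succ_ord_neq ij.
  exists (t * tperm i j)%g => [p|]; first by rewrite permM (permM x) refl_pair_fst // xt.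
  by rewrite odd_permM odd_tperm Nij /= n_odd addbT.
rewrite !inE => /orP[] /existsP[i /existsP[j]].
  by case/andP=> /eqP ij /eqP -> /step; apply.
by case/and3P=> /eqP ij _ /eqP -> /step; apply.
Qed.

Lemma simple_A_word s : exists n, s \in (simple_A m ^+ n)%g.
Proof. by apply: mem_expg_gen; rewrite gen_simple_A inE. Qed.

Lemma eq_fst_embed s (t : 'S_m) : (forall p, (embed_sym s p).1 = t p.1) -> t = s.
Proof. by move=> st; apply/permP => i; have := st (i, true); rewrite embed_symE. Qed.

Lemma sign_cox_length_C s :
  (-1) ^+ cox_length (simple_C m) (embed_sym s) = (-1) ^+ odd_perm s :> {poly int}.
Proof.
have [n /(mem_embed_expg embed_simple_C)/mem_expg_cox_length] := simple_A_word s.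
case/odd_word_C => t /eq_fst_embed ->; rewrite odd_embed_sym addbF => <-.
by rewrite signr_odd.
Qed.

Lemma sign_cox_length_D s :
  (-1) ^+ cox_length (simple_D m) (embed_sym s) = (-1) ^+ odd_perm s :> {poly int}.
Proof.
have [n /(mem_embed_expg embed_simple_D)/mem_expg_cox_length] := simple_A_word s.
by case/odd_word_D => t /eq_fst_embed -> <-; rewrite signr_odd.
Qed.

Lemma signed_act_embed s (a : 'rV[int]_m) : signed_act (embed_sym s) a = perm_act s a.
Proof. by apply/rowP => j; rewrite !mxE -embed_symV embed_symE /= mul1r. Qed.

Lemma W_C_neg w p : w \in W_C m -> w (p.1, ~~ p.2) = ((w p).1, ~~ (w p).2).
Proof. by rewrite inE => /forallP/(_ p)/eqP. Qed.

(** Provides the underlying permutation of [w]. If [i] and [j] have the same image up to sign, equal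
    signs give [i = j] and opposite signs give [w (i, false) = w (j, true)], which is impossible. *)
Lemma W_C_fst_inj w : w \in W_C m -> injective (fun i => (w (i, false)).1).
Proof.
move=> wW i j /= eq_ij; case eq_b: ((w (i, false)).2 == (w (j, false)).2).
  have /perm_inj[//] : w (i, false) = w (j, false).
  by rewrite [LHS]surjective_pairing [RHS]surjective_pairing eq_ij (eqP eq_b).
have /perm_inj[//] : w (i, false) = w (j, true).
rewrite (W_C_neg (j, false) wW) [LHS]surjective_pairing eq_ij.
by move: eq_b; do 2!case: (w _).2.
Qed.

(** After reindexing along the underlying permutation, each coordinate whose sign is changed turns
    [a 0 i] into its opposite and so costs twice [a 0 i]. *)
Lemma coord_sum_signed_act w (a : 'rV[int]_m) : w \in W_C m ->
  coord_sum (signed_act w a) =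
  coord_sum a - 2 * \sum_(i | (w (i, false)).2) a 0 i.
Proof.
move=> wW; rewrite /coord_sum (reindex_inj (W_C_fst_inj wW)) /=.
rewrite mulr_sumr (big_mkcond (fun i => (w (i, false)).2)) -sumrB /=.
apply: eq_bigr => i _; rewrite mxE.
have -> : (w^-1)%g ((w (i, false)).1, false) = (i, (w (i, false)).2).
  apply: (@perm_inj _ w); rewrite permKV; case eq_b: (w (i, false)).2.
    by rewrite (W_C_neg (i, false) wW) eq_b.
  by rewrite [RHS]surjective_pairing eq_b.
by case: (w (i, false)).2 => /=; ring.
Qed.

Lemma embed_W_D s : embed_sym s \in W_D m.
Proof.
rewrite !inE; apply/andP; split; first by apply/forallP => p; rewrite !embed_symE.
by rewrite (eq_card0 (A := _)) // => i; rewrite inE embed_symE.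
Qed.

Lemma W_D_sub_C w : w \in W_D m -> w \in W_C m.
Proof. by rewrite inE => /andP[]. Qed.

Lemma W_C_embed w : w \in W_C m -> (forall i, ~~ (w (i, false)).2) ->
  w \in codom embed_sym.
Proof.
move=> wW w_pos; apply/codomP; exists (perm (W_C_fst_inj wW)).
have w_false i : w (i, false) = ((w (i, false)).1, false).
  by rewrite [LHS]surjective_pairing (negbTE (w_pos i)).
apply/permP => -[i []]; rewrite embed_symE permE /=; last by rewrite -w_false.
by rewrite (W_C_neg (i, false) wW) (w_false i).
Qed.

(** Common reduction for types C and D: only the terms of the embedded symmetric group survive. *)
Lemma sum_signed_perm (W S : {set {perm 'I_m * bool}})
    (P : 'rV[int]_m -> {poly int}) (a b : 'rV[int]_m) :
  (forall s, embed_sym s \in W) ->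
  (forall s, (-1) ^+ cox_length S (embed_sym s) = (-1) ^+ odd_perm s :> {poly int}) ->
  (forall w, w \in W -> w \notin codom embed_sym -> P (signed_act w a - b) = 0) ->
  \sum_(w in W) (-1) ^+ cox_length S w * P (signed_act w a - b) =
  \sum_(s : 'S_m) (-1) ^+ odd_perm s * P (perm_act s a - b).
Proof.
move=> embW signS P0; rewrite (bigID (mem (codom embed_sym))) /= [X in _ + X]big1.
  rewrite addr0 (eq_bigl (mem (embed_sym @: setT))) => [|w].
    rewrite big_imset => [|s t _ _]; last exact: embed_sym_injective.
    by apply: eq_big => [s|s _]; rewrite ?inE // signS signed_act_embed.
  apply/andP/imsetP => [[_ /codomP[s ->]]|[s _ ->]]; first by exists s.
  by rewrite embW codom_f.
by move=> w /andP[wW w_emb]; rewrite P0 // mulr0.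
Qed.

(** Outside the symmetric group some coordinate [i] changes sign. This lowers the coordinate sum by
    at least [2 * a 0 i], since the other changes contribute nonnegatively, and makes it
    negative. *)
Lemma sum_W_C (a b : 'rV[int]_m) :
  (forall i, 0 <= a 0 i) -> (forall i, coord_sum a - coord_sum b < 2 * a 0 i) ->
  \sum_(w in W_C m) (-1) ^+ cox_length (simple_C m) w * KPC (signed_act w a - b) =
  \sum_(s : 'S_m) (-1) ^+ odd_perm s * KPC (perm_act s a - b).
Proof.
move=> a_ge0 a_gt; apply: sum_signed_perm => [s|s|w wW w_emb].
- exact/W_D_sub_C/embed_W_D.
- exact: sign_cox_length_C.
apply: KPC_eq0; rewrite /coord_sum; under eq_bigr do rewrite mxE [(- b) _ _]mxE.
rewrite sumrB -/(coord_sum _) -/(coord_sum b) coord_sum_signed_act //.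
have [i wi] : exists i, (w (i, false)).2.
  apply/existsP; rewrite -[X in is_true X]negbK negb_exists.
  by apply: contra w_emb => /forallP; apply: W_C_embed.
rewrite (bigD1 i) //=.
set rest := (X in 2 * (_ + X)); have : 0 <= rest by apply: sumr_ge0.
have := a_gt i.
by move: rest (a 0 i) (coord_sum a) (coord_sum b) => x y z t; lia.
Qed.

Lemma sum_W_D (a b : 'rV[int]_m) :
  (forall i, 0 <= a 0 i) ->
  (forall i j, i != j -> coord_sum a - coord_sum b < 2 * (a 0 i + a 0 j)) ->
  \sum_(w in W_D m) (-1) ^+ cox_length (simple_D m) w * KPD (signed_act w a - b) =
  \sum_(s : 'S_m) (-1) ^+ odd_perm s * KPD (perm_act s a - b).
Proof.
move=> a_ge0 a_gt; apply: sum_signed_perm => [s|s|w wW w_emb].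
- exact: embed_W_D.
- exact: sign_cox_length_D.
apply: KPD_eq0; rewrite /coord_sum; under eq_bigr do rewrite mxE [(- b) _ _]mxE.
rewrite sumrB -/(coord_sum _) -/(coord_sum b) coord_sum_signed_act ?W_D_sub_C //.
(* In type D the number of sign changes is even and nonzero, so there are two of them; hence a
   hypothesis on pairs of coordinates. *)
have : (1 < #|[set i | (w (i, false)).2]|)%N.
  have : #|[set i | (w (i, false)).2]| != 0%N.
    apply: contra w_emb; rewrite cards_eq0 => /eqP w0.
    apply: W_C_embed (W_D_sub_C wW) _ => i.
    by have := in_set0 i; rewrite -w0 inE => ->.
  by move: wW; rewrite inE => /andP[_]; case: #|_| => [|[]].
case/card_gt1P=> i [j [+ + Nij]]; rewrite !inE => wi wj.
rewrite (bigD1 i) //= (bigD1 j) /=; last by rewrite wj eq_sym.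
set rest := (X in 2 * (_ + (_ + X))); have : 0 <= rest by apply: sumr_ge0.
have := a_gt i j Nij.
by move: rest (a 0 i) (a 0 j) (coord_sum a) (coord_sum b) => x y z t c; lia.
Qed.

End EmbedSym.

(** * Comparison of the alternating sums *)

Lemma negrev_perm_act m (s : 'S_m) (a : 'rV[int]_m) :
  negrev (perm_act s a) = perm_act (s ^ perm (@rev_ord_inj m))%g (negrev a).
Proof.
apply/rowP => i; rewrite !mxE -conjVg; congr (- a 0 _).
have rev_perm j : perm (@rev_ord_inj m) j = rev_ord j by rewrite permE.
by rewrite -{2}[i]rev_ordK -(rev_perm (rev_ord i)) permJ rev_perm rev_ordK.
Qed.

Lemma perm_act_add_kappa m (s : 'S_m) (a : 'rV[int]_m) c :
  perm_act s (a + c *: kappa m) = perm_act s a + c *: kappa m.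
Proof. by apply/rowP => i; rewrite !mxE. Qed.

(** Conjugation by the reversal permutes the symmetric group and keeps signs; the multiple of
    [kappa] is fixed by permutations and cancels. The scalar [c] is left free to fit both choices of
    rho. *)
Lemma alternating_sum_negrev m (P : 'rV[int]_m -> {poly int}) a b c :
  \sum_(s : 'S_m) (-1) ^+ cox_length (simple_A m) s * P (negrev (perm_act s a - b)) =
  \sum_(s : 'S_m) (-1) ^+ odd_perm s *
    P (perm_act s (negrev a + c *: kappa m) - (negrev b + c *: kappa m)).
Proof.
rewrite [RHS](reindex_inj (conjg_inj (perm (@rev_ord_inj m)))) /=.
apply: eq_bigr => s _; rewrite sign_cox_length_A odd_permJ perm_act_add_kappa.
by rewrite opprD addrACA subrr addr0 -negrev_perm_act raddfB.
Qed.

(** * Conjugate partitions and shifted weights *)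

Lemma sum_conj_part m lam :
  all (fun p => (p <= m)%N) lam -> (\sum_(j < m) conj_part lam j = sumn lam)%N.
Proof.
elim: lam => [_|p lam IH /= /andP[p_le /IH <-]]; first by rewrite big1.
rewrite big_split /=; congr (_ + _)%N.
(* A part [p] adds one box to each of the first [p] columns, all of which are counted because
   [p <= m]. *)
rewrite -[RHS]card_ord -sum1_card (big_ord_widen m (fun=> 1%N)) // [RHS]big_mkcond.
by apply: eq_bigr => j _ /=; case: (_ < p)%N.
Qed.

Lemma all_leq_first_part lam :
  is_partition lam -> all (fun p => (p <= first_part lam)%N) lam.
Proof.
case: lam => //= p lam; rewrite /is_partition /= leqnn.
by rewrite path_sortedE => [/andP[]|x y z]; last exact: (rev_trans leq_trans).
Qed.

Lemma leq_conj_part lam i : (conj_part lam i <= conj_part lam 0)%N.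
Proof. by apply: sub_count => p; apply: leq_ltn_trans. Qed.

Lemma coord_sum_conj_vec m lam : is_partition lam -> (first_part lam <= m)%N ->
  coord_sum (conj_vec m lam) = (sumn lam)%:Z.
Proof.
move=> /all_leq_first_part lam_le le_m; rewrite -(@sum_conj_part m).
  by rewrite -natz natr_sum; apply: eq_bigr => j _; rewrite mxE natz.
by apply: sub_all lam_le => p p_le; apply: leq_trans le_m.
Qed.

Lemma coord_sumB m (a b : 'rV[int]_m) : coord_sum (a - b) = coord_sum a - coord_sum b.
Proof. by rewrite -sumrB; apply: eq_bigr => i _; rewrite !mxE. Qed.

Lemma coord_sum_negrev m (a : 'rV[int]_m) : coord_sum (negrev a) = - coord_sum a.
Proof.
rewrite /coord_sum (reindex_inj rev_ord_inj) -sumrN.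
by apply: eq_bigr => i _; rewrite mxE rev_ordK.
Qed.

Definition shifted m n (k : int) (rho0 : 'rV[int]_m) nu : 'rV[int]_m :=
  tilde m n nu + k *: kappa m + rho0.

(** Entry [i] of [rho m] reversed is [i + 1] and that of [rho_C m] is [m - i], whence the constant
    [m + 1]; for [rho_D m] it is [m]. *)
Lemma shifted_C m n k nu :
  shifted n k (rho_C m) nu =
  negrev (conj_vec m nu + rho m) + (n%:Z + k + m%:Z + 1) *: kappa m.
Proof. by apply/rowP => i; rewrite !mxE /=; have := ltn_ord i; lia. Qed.

Lemma shifted_D m n k nu :
  shifted n k (rho_D m) nu =
  negrev (conj_vec m nu + rho m) + (n%:Z + k + m%:Z) *: kappa m.
Proof. by apply/rowP => i; rewrite !mxE /=; have := ltn_ord i; lia. Qed.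

(** The contributions of [n], [k] and [rho0] cancel, and complementation reverses the sign of the
    difference of sizes. *)
Lemma coord_sum_shifted m n k (rho0 : 'rV[int]_m) lam mu :
  is_partition lam -> is_partition mu ->
  (first_part lam <= m)%N -> (first_part mu <= m)%N ->
  coord_sum (shifted n k rho0 lam) - coord_sum (shifted n k rho0 mu) =
  (sumn mu)%:Z - (sumn lam)%:Z.
Proof.
move=> lam_part mu_part lam_le mu_le.
rewrite -(coord_sum_conj_vec lam_part lam_le) -(coord_sum_conj_vec mu_part mu_le).
rewrite -opprB -!coord_sumB -coord_sum_negrev.
by congr coord_sum; apply/rowP => i; rewrite !mxE !rev_ordK; ring.
Qed.

Lemma shifted_ge m n k (rho0 : 'rV[int]_m) lam i :
  (conj_part lam 0 <= n)%N -> k + rho0 0 i <= shifted n k rho0 lam 0 i.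
Proof.
move=> lam_n; rewrite !mxE mulr1 -addrA lerDr subr_ge0 lez_nat.
exact: leq_trans (leq_conj_part _ _) lam_n.
Qed.

Lemma U_KC m n lam mu k :
  is_partition lam -> is_partition mu ->
  (first_part lam <= m)%N -> (first_part mu <= m)%N ->
  (conj_part lam 0 <= n)%N -> 0 <= k -> (sumn mu)%:Z - (sumn lam)%:Z <= 2 * k ->
  U (conj_vec m lam) (conj_vec m mu) =
  KC (tilde m n lam + k *: kappa m) (tilde m n mu + k *: kappa m).
Proof.
move=> lam_part mu_part lam_le mu_le lam_n k_ge0 k_ge.
(* The smallest entry of [rho_C] is 1, which keeps the required inequality strict when [2 * k]
   equals the difference of sizes. *)
have ge_i i : k + 1 <= shifted n k (rho_C m) lam 0 i.
  apply: le_trans (shifted_ge k _ i lam_n); rewrite mxE.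
  by have := ltn_ord i; lia.
rewrite /KC sum_W_C -/(shifted n k _ lam) -/(shifted n k _ mu).
- rewrite !shifted_C -alternating_sum_negrev; apply: eq_bigr => s _.
  by rewrite Fq_negrev -addrA -opprD.
- by move=> i; apply: le_trans (ge_i i); rewrite addr_ge0.
move=> i; rewrite coord_sum_shifted //.
by move: (shifted _ _ _ _ _ _) (ge_i i) => x; lia.
Qed.

Lemma u_KD m n lam mu k :
  is_partition lam -> is_partition mu ->
  (first_part lam <= m)%N -> (first_part mu <= m)%N ->
  (conj_part lam 0 <= n)%N -> 0 <= k -> (sumn mu)%:Z - (sumn lam)%:Z <= 2 * k ->
  u (conj_vec m lam) (conj_vec m mu) =
  KD (tilde m n lam + k *: kappa m) (tilde m n mu + k *: kappa m).
Proof.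
move=> lam_part mu_part lam_le mu_le lam_n k_ge0 k_ge.
(* The entry of [rho_D] stays in the bound: it is 0 in the last coordinate, so for [k = 0]
   strictness has to come from a pair. *)
have ge_i (i : 'I_m) : k + (m%:Z - i.+1%:Z) <= shifted n k (rho_D m) lam 0 i.
  by apply: le_trans (shifted_ge k _ i lam_n); rewrite mxE.
rewrite /KD sum_W_D -/(shifted n k _ lam) -/(shifted n k _ mu).
- rewrite !shifted_D -alternating_sum_negrev; apply: eq_bigr => s _.
  by rewrite fq_negrev -addrA -opprD.
- move=> i; apply: le_trans (ge_i i).
  by have := ltn_ord i; lia.
(* The entries of rho_D are distinct, so two of them add up to at least 1. *)
move=> i j; rewrite -val_eqE /= => Nij; rewrite coord_sum_shifted //.
move: (shifted _ _ _ _ 0 i) (shifted _ _ _ _ 0 j) (ge_i i) (ge_i j) => x y.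
by have := ltn_ord i; have := ltn_ord j; lia.
Qed.

Theorem theorem5p2p1 (l : nat) (lam mu : l.-tuple nat) (k : int)
    (hlam : is_partition lam) (hmu : is_partition mu)
    (hmul : (sumn mu <= l)%N) (hlammu : (sumn lam <= sumn mu)%N)
    (hk : ((sumn mu)%:Q - (sumn lam)%:Q) / 2 <= k%:Q) :
  let m := max_first lam mu in
  let n := max_conj_first lam mu in
  v lam mu = KD (tilde m n lam + k *: kappa m) (tilde m n mu + k *: kappa m)
  /\
  V lam mu = KC (tilde m n lam + k *: kappa m) (tilde m n mu + k *: kappa m).
Proof.
move=> m n.
(* Clearing the denominator gives an integer inequality, from which [k] is nonnegative because
   [sumn lam <= sumn mu]. *)
have k_ge : (sumn mu)%:Z - (sumn lam)%:Z <= 2 * k.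
  by rewrite -(ler_int rat) rmorphB rmorphM /=; lra.
have k_ge0 : 0 <= k by move: hlammu k_ge; lia.
by split; [apply: u_KD | apply: U_KC]; rewrite ?leq_maxl ?leq_maxr.
Qed.
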